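(* Let $\mathcal{I}\subset\mathbb{R}[\boldsymbol{x}]$ be an ideal. The quadratic module $\Sigma(\mathcal{I})$ of $\mathcal{I}$ is Archimedean in $\mathbb{R}[\boldsymbol{x}]/\mathcal{I}$ if and only if there exist $\mathcal{I}$-spherical polynomials $h_1,\dots,h_m\in\mathbb{R}[\boldsymbol{x}]$ such that $h_1+\mathcal{I},\dots,h_m+\mathcal{I}$ generate $\mathbb{R}[\boldsymbol{x}]/\mathcal{I}$ as an $\mathbb{R}$-algebra.
   Context: $\mathbb{R}[\boldsymbol{x}]$ is the polynomial ring in $\boldsymbol{x}=(x_1,\dots,x_n)$. The quadratic module of an ideal $\mathcal{I}$ is $\Sigma(\mathcal{I})=\{\sum_{i=1}^s q_i^2+\mathcal{I}: q_1,\dots,q_s\in\mathbb{R}[\boldsymbol{x}],\ s\in\mathbb{N}\}\subset\mathbb{R}[\boldsymbol{x}]/\mathcal{I}$. It is Archimedean in $\mathbb{R}[\boldsymbol{x}]/\mathcal{I}$ if there exists $N\in\mathbb{N}$ with $(N-\sum_{i=1}^n x_i^2)+\mathcal{I}\in\Sigma(\mathcal{I})$. Polynomials $h_1,\dots,h_m$ are $\mathcal{I}$-spherical if $\sum_{i=1}^m h_i^2-1\in\mathcal{I}$. *)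

(* Defs.v *)
From HB Require Import structures.
From mathcomp Require Import all_boot all_order all_algebra.
From mathcomp Require Import boolp classical_sets reals.
From mathcomp Require Import mpoly.

Set Implicit Arguments.
Unset Strict Implicit.
Unset Printing Implicit Defensive.

Import GRing.Theory.

Local Open Scope ring_scope.
Local Open Scope quotient_scope.

(* Unlike the library's [idealr], an ideal is a Prop-valued set, so that it is
   not restricted to decidable subsets, and it may be the whole ring. *)
Record ideal (A : comNzRingType) := Ideal {
  ideal_carrier :> A -> Prop;
  ideal0 : ideal_carrier 0;
  idealD : forall x y, ideal_carrier x -> ideal_carrier y ->
             ideal_carrier (x + y);
  idealM : forall a x, ideal_carrier x -> ideal_carrier (a * x) }.

Definition ideal_mem (A : comNzRingType) (I : ideal A) : {pred A} :=
  fun x => `[< I x >].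

Lemma ideal_memE (A : comNzRingType) (I : ideal A) x :
  (x \in ideal_mem I) = `[< I x >].
Proof. by []. Qed.

Lemma ideal_mem_zmod_closed (A : comNzRingType) (I : ideal A) :
  zmod_closed (ideal_mem I).
Proof.
split=> [|x y]; rewrite !ideal_memE; first exact/asboolP/ideal0.
move=> /asboolP Ix /asboolP Iy; apply/asboolP; apply: idealD => //.
by rewrite -mulN1r; apply: idealM.
Qed.

HB.instance Definition _ (A : comNzRingType) (I : ideal A) :=
  GRing.isZmodClosed.Build A (ideal_mem I) (ideal_mem_zmod_closed I).

(* The library makes {quot I} a ring only when 1 is not in I, because its
   rings there are nontrivial. Here the quotient is a [comPzRingType], so the
   zero ring is allowed. *)
Definition quotient (A : comNzRingType) (I : ideal A) : Type :=
  Quotient.quot (ideal_mem I).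

HB.instance Definition _ (A : comNzRingType) (I : ideal A) :=
  GRing.Zmodule.on (quotient I).
HB.instance Definition _ (A : comNzRingType) (I : ideal A) :
    EqQuotient A (Quotient.equiv (ideal_mem I)) (quotient I) :=
  EqQuotient.on (quotient I).

Definition coset (A : comNzRingType) (I : ideal A) (x : A) : quotient I :=
  \pi_(quotient I) x.

Section QuotientRing.
Variables (A : comNzRingType) (I : ideal A).

Lemma coset_eqP x y : reflect (coset I x = coset I y) (`[< I (x - y) >]).
Proof.
rewrite -ideal_memE (Quotient.idealrBE (ideal_mem I)).
exact: (iffP eqP).
Qed.

Lemma coset_repr (u : quotient I) : coset I (repr u) = u.
Proof. exact: reprK. Qed.

Lemma coset_subset (x : A) : I (x - repr (coset I x)).
Proof. by apply/asboolP/coset_eqP; rewrite coset_repr. Qed.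

Lemma cosetD x y : coset I (x + y) = coset I x + coset I y.
Proof. exact: (Quotient.pi_add (ideal_mem I)). Qed.

Definition quot_mul (u v : quotient I) : quotient I :=
  coset I (repr u * repr v).

Lemma cosetM_subproof x y :
  coset I (x * y) = quot_mul (coset I x) (coset I y).
Proof.
apply/coset_eqP/asboolP.
set x' := repr _; set y' := repr _.
have -> : x * y - x' * y' = y * (x - x') + x' * (y - y').
  by rewrite !mulrBr [y * x]mulrC [y * x']mulrC addrA subrK.
by apply: idealD; apply/idealM/coset_subset.
Qed.

Lemma quot_mulA : associative quot_mul.
Proof.
move=> u v w; rewrite -[u]coset_repr -[v]coset_repr -[w]coset_repr.
by rewrite -!cosetM_subproof mulrA.
Qed.

Lemma quot_mulC : commutative quot_mul.
Proof. by move=> u v; rewrite /quot_mul mulrC. Qed.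

Lemma quot_mul1 : left_id (coset I 1) quot_mul.
Proof.
by move=> u; rewrite -[u]coset_repr -cosetM_subproof mul1r.
Qed.

Lemma quot_mulDl : left_distributive quot_mul +%R.
Proof.
move=> u v w; rewrite -[u]coset_repr -[v]coset_repr -[w]coset_repr.
by rewrite -cosetD -!cosetM_subproof -cosetD mulrDl.
Qed.

HB.instance Definition _ := GRing.Zmodule_isComPzRing.Build (quotient I)
  quot_mulA quot_mulC quot_mul1 quot_mulDl.

Lemma coset1 : coset I 1 = 1.
Proof. by []. Qed.

Lemma cosetM x y : coset I (x * y) = coset I x * coset I y.
Proof. exact: cosetM_subproof. Qed.

End QuotientRing.

Section QuotientModule.
Variables (R : comNzRingType) (A : comAlgType R) (I : ideal A).

Definition quot_scale (a : R) (u : quotient I) : quotient I :=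
  coset I (a *: repr u).

Lemma cosetZ_subproof a x : coset I (a *: x) = quot_scale a (coset I x).
Proof.
apply/coset_eqP/asboolP; rewrite -scalerBr -mulr_algl.
exact/idealM/coset_subset.
Qed.

Lemma quot_scaleA a b u : quot_scale a (quot_scale b u) = quot_scale (a * b) u.
Proof. by rewrite -[u]coset_repr -!cosetZ_subproof scalerA. Qed.

Lemma quot_scale1 : left_id 1 quot_scale.
Proof. by move=> u; rewrite -[u]coset_repr -cosetZ_subproof scale1r. Qed.

Lemma quot_scaleDr : right_distributive quot_scale +%R.
Proof.
move=> a u v; rewrite -[u]coset_repr -[v]coset_repr.
by rewrite -cosetD -!cosetZ_subproof -cosetD scalerDr.
Qed.

Lemma quot_scaleDl u : {morph quot_scale^~ u : a b / a + b}.
Proof.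
move=> a b; rewrite -[u]coset_repr.
by rewrite -!cosetZ_subproof -cosetD scalerDl.
Qed.

HB.instance Definition _ := GRing.Zmodule_isLmodule.Build R (quotient I)
  quot_scaleA quot_scale1 quot_scaleDr quot_scaleDl.

Lemma cosetZ a x : coset I (a *: x) = a *: coset I x.
Proof. exact: cosetZ_subproof. Qed.

Lemma quot_scaleAl (a : R) (u v : quotient I) : a *: (u * v) = (a *: u) * v.
Proof.
rewrite -[u]coset_repr -[v]coset_repr.
by rewrite -cosetM -!cosetZ -cosetM scalerAl.
Qed.

(* The closure conditions are those of the library's [subalg_closed], which is
   not applicable because it requires a nontrivial algebra. Boolean predicates
   are as general as arbitrary sets here, through boolp's excluded middle. *)
Definition generates_algebra (m : nat) (g : 'I_m -> quotient I) : Prop :=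
  forall S : {pred quotient I},
    [/\ 1 \in S, GRing.linear_closed S & GRing.mulr_2closed S] ->
    (forall i, g i \in S) ->
    forall u, u \in S.

End QuotientModule.

Section Spherical.
Variables (R : realType) (n : nat) (I : ideal {mpoly R[n]}).

Definition quadratic_module : set (quotient I) :=
  [set u | exists (s : nat) (q : 'I_s -> {mpoly R[n]}),
             u = coset I (\sum_(i < s) q i ^+ 2)].

Definition archimedean : Prop :=
  exists N : nat,
    quadratic_module (coset I (N%:R - \sum_(i < n) 'X_i ^+ 2)).

Definition spherical (m : nat) (h : 'I_m -> {mpoly R[n]}) : Prop :=
  I (\sum_(i < m) h i ^+ 2 - 1).

End Spherical.

Arguments quadratic_module {R n} I _.

(* Main.v *)
Require Import Defs.
From mathcomp Require Import all_boot all_order all_algebra.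
From mathcomp Require Import ring.
From mathcomp Require Import boolp reals.
From mathcomp Require Import mpoly.

(** If [N - sum x_i^2] is a sum of squares [sum q_j^2] modulo [I] with [N > 0],
    then the [x_i / sqrt N] and [q_j / sqrt N] together are [I]-spherical.
    Conversely, the classes of the [f] such that [c - f^2] is a sum of squares
    modulo [I] for some real [c >= 0] form a subalgebra of the quotient; it
    contains every [h_i] of a spherical family, because
    [1 - h_i^2 = sum_(j != i) h_j^2] modulo [I], hence it contains the [x_i]
    when the [h_i] generate. *)

Set Implicit Arguments.
Unset Strict Implicit.
Unset Printing Implicit Defensive.

Import Order.TTheory GRing.Theory Num.Theory.
Local Open Scope ring_scope.

Section Coset.
Variables (A : comNzRingType) (I : ideal A).

Lemma eq_coset x y : I (x - y) -> coset I x = coset I y.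
Proof. by move=> Ixy; apply/coset_eqP/asboolP. Qed.

Lemma coset_eq_ideal x y : coset I x = coset I y -> I (x - y).
Proof. by move=> /coset_eqP/asboolP. Qed.

End Coset.

Section QuadraticModule.
Variables (R : realType) (n : nat) (I : ideal {mpoly R[n]}).
Implicit Types (f g p : {mpoly R[n]}) (c d : R).

Definition sos_mod f : Prop := quadratic_module I (coset I f).

Lemma sos_mod0 : sos_mod 0.
Proof. by exists 0, (fun=> 0); rewrite big_ord0. Qed.

Lemma sos_mod_sqr p : sos_mod (p ^+ 2).
Proof. by exists 1, (fun=> p); rewrite big_ord1. Qed.

Lemma sos_modD f g : sos_mod f -> sos_mod g -> sos_mod (f + g).
Proof.
move=> [s [q fE]] [t [r gE]].
exists (s + t), (fun k => match split k with inl i => q i | inr j => r j end).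
rewrite cosetD fE gE -cosetD big_split_ord /=; congr (coset I (_ + _)).
  by apply: eq_bigr => i _; rewrite (unsplitK (inl i)).
by apply: eq_bigr => j _; rewrite (unsplitK (inr j)).
Qed.

Lemma sos_mod_bigsum (J : Type) (r : seq J) (P : pred J)
    (F : J -> {mpoly R[n]}) :
  (forall j, P j -> sos_mod (F j)) -> sos_mod (\sum_(j <- r | P j) F j).
Proof.
by move=> sF; apply: big_ind => //; [exact: sos_mod0|exact: sos_modD].
Qed.

Lemma sos_mod_sqrM p f : sos_mod f -> sos_mod (p ^+ 2 * f).
Proof.
move=> [s [q fE]]; exists s, (fun i => p * q i).
rewrite cosetM fE -cosetM mulr_sumr; congr (coset I _).
by apply: eq_bigr => i _; rewrite exprMn.
Qed.

Lemma mpolyC_sqrt c : 0 <= c -> c%:MP_[n] = (Num.sqrt c)%:MP_[n] ^+ 2.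
Proof. by move=> c0; rewrite -rmorphXn /= sqr_sqrtr. Qed.

Lemma sos_modC c : 0 <= c -> sos_mod c%:MP_[n].
Proof. by move=> c0; rewrite mpolyC_sqrt //; exact: sos_mod_sqr. Qed.

Lemma sos_modCM c f : 0 <= c -> sos_mod f -> sos_mod (c%:MP_[n] * f).
Proof. by move=> c0; rewrite mpolyC_sqrt //; exact: sos_mod_sqrM. Qed.

(** The sign of [c] is recorded because the product rule multiplies a sum of squares by such a
    bound, which is harmless only for nonnegative constants. *)
Definition sqr_bounded_mod f : Prop :=
  exists2 c, 0 <= c & sos_mod (c%:MP_[n] - f ^+ 2).

Lemma sqr_bounded_modC c : sqr_bounded_mod c%:MP_[n].
Proof.
exists (c ^+ 2); first exact: sqr_ge0.
by rewrite rmorphXn subrr; exact: sos_mod0.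
Qed.

(** The parallelogram identity [(f + g)^2 + (f - g)^2 = 2 f^2 + 2 g^2] yields the bound
    [2 (c + d)]. *)
Lemma sqr_bounded_modD f g :
  sqr_bounded_mod f -> sqr_bounded_mod g -> sqr_bounded_mod (f + g).
Proof.
move=> [c c0 sf] [d d0 sg]; exists (2 * (c + d)).
  by rewrite mulr_ge0 ?addr_ge0.
have -> : (2 * (c + d))%:MP_[n] - (f + g) ^+ 2 =
    2%:MP_[n] * (c%:MP - f ^+ 2) + 2%:MP_[n] * (d%:MP - g ^+ 2) + (f - g) ^+ 2.
  by rewrite mpolyCM mpolyC_nat mpolyCD; ring.
by apply: sos_modD; [apply: sos_modD; apply: sos_modCM|exact: sos_mod_sqr].
Qed.

Lemma sqr_bounded_modM f g :
  sqr_bounded_mod f -> sqr_bounded_mod g -> sqr_bounded_mod (f * g).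
Proof.
move=> [c c0 sf] [d d0 sg]; exists (c * d); first exact: mulr_ge0.
have -> : (c * d)%:MP_[n] - (f * g) ^+ 2 =
    d%:MP * (c%:MP - f ^+ 2) + f ^+ 2 * (d%:MP - g ^+ 2).
  by rewrite rmorphM /=; ring.
by apply: sos_modD; [apply: sos_modCM|apply: sos_mod_sqrM].
Qed.

Lemma sqr_bounded_mod_generated m (h : 'I_m -> {mpoly R[n]}) :
  generates_algebra (fun i => coset I (h i)) ->
  (forall i, sqr_bounded_mod (h i)) -> forall f, sqr_bounded_mod f.
Proof.
move=> gen hB f.
pose B : {pred quotient I} :=
  fun u => `[< exists2 f, u = coset I f & sqr_bounded_mod f >].
(* Membership in [B] only provides some bounded representative [g]; the bound passes to [f] because
   [f^2 - g^2] is a multiple of [f - g], which lies in [I]. *)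
suff /asboolP [g fg [c c0 sg]] : coset I f \in B.
  exists c => //; rewrite /sos_mod.
  suff -> : coset I (c%:MP - f ^+ 2) = coset I (c%:MP - g ^+ 2) by [].
  apply: eq_coset.
  have -> : c%:MP - f ^+ 2 - (c%:MP - g ^+ 2) = - (f + g) * (f - g) by ring.
  exact/idealM/coset_eq_ideal.
apply: gen => [|i]; last by apply/asboolP; exists (h i).
split.
- by apply/asboolP; exists 1 => //; rewrite -[1]mpolyC1; exact: sqr_bounded_modC.
- move=> a _ _ /asboolP[p -> pB] /asboolP[q -> qB].
  apply/asboolP; exists (a *: p + q); first by rewrite cosetD cosetZ.
  (* Scaling is multiplication by a constant polynomial, so the product rule covers it. *)
  rewrite -mul_mpolyC; apply: sqr_bounded_modD => //.
  by apply: sqr_bounded_modM => //; exact: sqr_bounded_modC.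
- move=> _ _ /asboolP[p -> pB] /asboolP[q -> qB].
  by apply/asboolP; exists (p * q); [rewrite cosetM|exact: sqr_bounded_modM].
Qed.

Lemma spherical_sqr_bounded_mod m (h : 'I_m -> {mpoly R[n]}) :
  spherical I h -> forall i, sqr_bounded_mod (h i).
Proof.
move=> sph i; exists 1 => //; rewrite /sos_mod.
move: sph; rewrite /spherical (bigD1 i) //= => sph.
have -> : coset I (1%:MP - h i ^+ 2) = coset I (\sum_(j < m | j != i) h j ^+ 2).
  (* The difference of the two sides is -1 times the spherical relation. *)
  apply: eq_coset; rewrite mpolyC1 -opprB -mulN1r; apply: idealM.
  by rewrite opprB addrA (addrC _ (h i ^+ 2)).
by apply: sos_mod_bigsum => j _; exact: sos_mod_sqr.
Qed.

(** Adding up the bounds of the variables gives a real bound [C] for the sum of their squares;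
    raising it to a natural number [N] adds a nonnegative constant, itself a square. *)
Lemma sqr_bounded_mod_archimedean :
  (forall i : 'I_n, sqr_bounded_mod 'X_i) -> archimedean I.
Proof.
move=> XB; have /choice[c cP] : forall i : 'I_n,
    exists c : R, sos_mod (c%:MP_[n] - 'X_i ^+ 2).
  by move=> i; have [c _ sc] := XB i; exists c.
pose C := \sum_i c i; pose N := Num.bound `|C|; exists N.
have -> : N%:R - \sum_(i < n) 'X_i ^+ 2 =
    (N%:R - C)%:MP_[n] + \sum_(i < n) ((c i)%:MP - 'X_i ^+ 2).
  have CE : C%:MP_[n] = \sum_i (c i)%:MP by exact: raddf_sum.
  by rewrite mpolyCB mpolyC_nat sumrB CE addrA subrK.
apply: sos_modD; last exact: sos_mod_bigsum.
apply: sos_modC; rewrite subr_ge0; apply: le_trans (ler_norm C) _.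
exact/ltW/archi_boundP.
Qed.

(** Undoing the scaling by [r] recovers the variables, and every polynomial is a linear combination
    of products of them. The family [g] may have further members. *)
Lemma generates_algebra_vars m (g : 'I_m -> quotient I) (r : R) :
  r != 0 -> (forall i : 'I_n, exists k, g k = coset I (r *: 'X_i)) ->
  generates_algebra g.
Proof.
move=> r0 gX S [S1 Slin SM] Sg u; rewrite -[u]coset_repr.
(* Linear closure concerns [a *: u + v]; zero, scaling and addition are extracted from it one by
   one. *)
have S0 : 0 \in S by have := Slin (-1) _ _ S1 S1; rewrite scaleN1r addNr.
have SZ a v : v \in S -> a *: v \in S.
  by move=> Sv; have := Slin a _ _ Sv S0; rewrite addr0.
have SD v w : v \in S -> w \in S -> v + w \in S.
  by move=> Sv Sw; have := Slin 1 _ _ Sv Sw; rewrite scale1r.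
have SX i : coset I 'X_i \in S.
  have [k gk] := gX i; have := SZ r^-1 _ (Sg k).
  by rewrite gk -cosetZ scalerA mulVf // scale1r.
rewrite [repr u]mpolyE.
apply: (big_ind (fun p => coset I p \in S)) => [|p q|mon _].
- suff -> : coset I 0 = 0 by [].
  by apply: (addrI (coset I 0)); rewrite -cosetD !addr0.
- by rewrite cosetD; exact: SD.
rewrite cosetZ; apply: SZ; rewrite mpolyXE_id.
apply: (big_ind (fun p => coset I p \in S)) => [//|p q|i _].
  by rewrite cosetM; exact: SM.
elim: (mon i) => [//|k IHk]; rewrite exprS cosetM; exact: SM.
Qed.

Lemma archimedean_spherical : archimedean I ->
  exists (m : nat) (h : 'I_m -> {mpoly R[n]}),
    spherical I h /\ generates_algebra (fun i => coset I (h i)).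
Proof.
(* Adding 1 to [N] makes the division by [sqrt N] legitimate. *)
move=> [N]; rewrite -/(sos_mod _) => /(sos_modD (sos_mod_sqr 1)) [s [q qE]].
pose r : R := (Num.sqrt N.+1%:R)^-1.
have r0 : r != 0 by rewrite invr_eq0 sqrtr_eq0 -ltNge ltr0Sn.
have r2 : r ^+ 2 * N.+1%:R = 1.
  by rewrite exprVn sqr_sqrtr ?ler0n // mulVf ?pnatr_eq0.
pose h (k : 'I_(n + s)) : {mpoly R[n]} :=
  r *: match split k with inl i => 'X_i | inr j => q j end.
have hl i : h (lshift s i) = r *: 'X_i by rewrite /h (unsplitK (inl i)).
have hr j : h (rshift n j) = r *: q j by rewrite /h (unsplitK (inr j)).
exists (n + s), h; split; last first.
  by apply: (generates_algebra_vars r0) => i; exists (lshift s i); rewrite hl.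
rewrite /spherical.
(* With 1 written as [r^2 (N + 1)], the factor [- r^2] comes out and leaves the relation [qE], whose
   two sides differ by an element of [I]. *)
have -> : \sum_(k < n + s) h k ^+ 2 - 1 = - (r ^+ 2)%:MP_[n] *
    (1 ^+ 2 + (N%:R - \sum_(i < n) 'X_i ^+ 2) - \sum_(j < s) q j ^+ 2).
  rewrite big_split_ord /= -[X in _ - X = _](mpolyC1 n) -r2 mpolyCM mpolyC_nat.
  under eq_bigr => i _ do rewrite hl exprZn -mul_mpolyC.
  under [X in _ + X - _]eq_bigr => j _ do rewrite hr exprZn -mul_mpolyC.
  by rewrite -!mulr_sumr -natr1; ring.
exact/idealM/coset_eq_ideal.
Qed.

End QuadraticModule.

Theorem proposition4p1 (R : realType) (n : nat) (I : ideal {mpoly R[n]}) :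
  archimedean I <->
  exists (m : nat) (h : 'I_m -> {mpoly R[n]}),
    spherical I h /\ generates_algebra (fun i : 'I_m => coset I (h i)).
Proof.
split=> [|[m [h [sph gen]]]]; first exact: archimedean_spherical.
apply: sqr_bounded_mod_archimedean => i.
exact: (sqr_bounded_mod_generated gen (spherical_sqr_bounded_mod sph)).
Qed.
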